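(* Let $(x_n)_{n\geq 0}$ be a sequence of integers satisfying $x_n=b_1x_{n-1}+b_2x_{n-2}+b_3x_{n-3}$ for all integers $n\geq 3$, where $b_1,b_2,b_3,x_0,x_1,x_2\in\mathbb{Z}$ and $b_3\neq 0$. Suppose that the characteristic polynomial $x^3-b_1x^2-b_2x-b_3$ equals $(x-a)(x-b)(x-c)$ with $a,b,c\in\mathbb{Z}$. Let $p$ be a prime with $p\nmid abc$. Then: (a) Suppose $a=b=c$. If $p\mid x_0$ and $p\nmid 4ax_1-x_2-3a^2x_0$, then the quotient set of $(x_n)_{n\geq 0}$ is dense in $\mathbb{Q}_p$. Moreover, if $x_0=0$, then the quotient set of $(x_n)_{n\geq 0}$ is dense in $\mathbb{Q}_p$ if and only if $4ax_1\neq x_2$. (b) Suppose $a=c\neq b$. If $p\mid x_0$ and $p\nmid (a-b)\bigl(x_2-x_1(a+b)+x_0ab\bigr)$, then the quotient set of $(x_n)_{n\geq 0}$ is dense in $\mathbb{Q}_p$.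
   Context: The quotient set (ratio set) of a sequence $(x_n)_{n\ge0}$ of integers is $\{x_m/x_n : m,n\geq 0,\ x_n\neq 0\}$. $\mathbb{Q}_p$ denotes the field of $p$-adic numbers with the $p$-adic topology. *)

(* Defs.v *)
From HB Require Import structures.
From mathcomp Require Import all_boot all_order all_algebra.
From mathcomp Require Import ring_quotient.
From mathcomp Require Import boolp classical_sets functions topology.

Set Implicit Arguments.
Unset Strict Implicit.
Unset Printing Implicit Defensive.

Import Order.TTheory GRing.Theory Num.Theory.

Local Open Scope classical_set_scope.
Local Open Scope ring_scope.

(* The p-adic absolute value on rat. The field Q_p is built below as the
   completion of rat for it: Cauchy sequences modulo null sequences. Since
   [logn p] vanishes when p is not prime, the absolute value is then the trivial
   one, so the construction needs no primality hypothesis. *)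
Definition ratnorm (p : nat) (x : rat) : rat :=
  if x == 0 then 0
  else p%:R ^ ((logn p `|denq x|%N)%:Z - (logn p `|numq x|%N)%:Z).

Section RatNorm.
Variable p : nat.
Local Notation nrm := (ratnorm p).

Lemma logn_nprime m : ~~ prime p -> logn p m = 0%N.
Proof. by move=> np; rewrite lognE (negbTE np). Qed.

Lemma ratnorm0 : nrm 0 = 0.
Proof. by rewrite /ratnorm eqxx. Qed.

Lemma ratnorm_gt0 x : (0 < nrm x) = (x != 0).
Proof.
rewrite /ratnorm; case: eqVneq => [_|x0]; first by rewrite ltxx.
have [pp|np] := boolP (prime p).
  by rewrite exprz_gt0 // ltr0n prime_gt0.
by rewrite !logn_nprime // subrr expr0z.
Qed.

Lemma ratnorm_ge0 x : 0 <= nrm x.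
Proof.
have [->|x0] := eqVneq x 0; first by rewrite ratnorm0.
by rewrite ltW // ratnorm_gt0.
Qed.

Lemma ratnorm_eq0 x : (nrm x == 0) = (x == 0).
Proof.
by apply/idP/idP => [|/eqP->]; [apply: contraTT; rewrite -ratnorm_gt0 => /gt_eqF->
                               | rewrite ratnorm0].
Qed.

Lemma ratnorm_frac (n d : int) : n != 0 -> d != 0 ->
  nrm (n%:~R / d%:~R) = p%:R ^ ((logn p `|d|%N)%:Z - (logn p `|n|%N)%:Z).
Proof.
move=> n0 d0; set x := _ / _.
have x0 : x != 0 by rewrite mulf_neq0 // ?invr_eq0 intr_eq0.
have e : n * denq x = numq x * d.
  apply: (@intr_inj rat); rewrite !rmorphM /= numqE mulrAC divfK // intr_eq0 //.
rewrite /ratnorm (negbTE x0); congr (_ ^ _).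
have /(congr1 (logn p)) : (`|n| * `|denq x| = `|numq x| * `|d|)%N.
  by rewrite -!abszM e.
rewrite !lognM ?absz_gt0 ?denq_neq0 // ?numq_eq0 // => /(congr1 Posz).
rewrite !PoszD => E; apply/eqP; rewrite subr_eq addrAC eq_sym subr_eq.
by rewrite addrC -E addrC.
Qed.

Lemma ratnorm1 : nrm 1 = 1.
Proof. by rewrite /ratnorm oner_eq0 /= logn1 subrr expr0z. Qed.

Lemma ratnormN x : nrm (- x) = nrm x.
Proof. by rewrite /ratnorm oppr_eq0 numqN denqN abszN. Qed.

Lemma ratnormM x y : nrm (x * y) = nrm x * nrm y.
Proof.
have [->|x0] := eqVneq x 0; first by rewrite mul0r ratnorm0 mul0r.
have [->|y0] := eqVneq y 0; first by rewrite mulr0 ratnorm0 mulr0.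
have nx : numq x != 0 by rewrite numq_eq0.
have ny : numq y != 0 by rewrite numq_eq0.
have dx := denq_neq0 x; have dy := denq_neq0 y.
rewrite -{1}(divq_num_den x) -{1}(divq_num_den y) mulf_div -!intrM.
rewrite ratnorm_frac ?mulf_neq0 // /ratnorm (negbTE x0) (negbTE y0).
rewrite !abszM !lognM ?absz_gt0 //.
have [pp|np] := boolP (prime p); last by rewrite !logn_nprime // subrr expr0z mulr1.
rewrite -expfzDr ?pnatr_eq0 -?lt0n ?prime_gt0 //; congr (_ ^ _).
by rewrite !PoszD opprD addrACA.
Qed.

Lemma ratnormD x y : nrm (x + y) <= Num.max (nrm x) (nrm y).
Proof.
have [->|x0] := eqVneq x 0; first by rewrite add0r le_max lexx orbT.
have [->|y0] := eqVneq y 0; first by rewrite addr0 le_max lexx.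
have [->|z0] := eqVneq (x + y) 0.
  by rewrite ratnorm0 le_max ratnorm_ge0.
have [pp|np] := boolP (prime p); last first.
  by rewrite /ratnorm (negbTE x0) (negbTE y0) (negbTE z0) !logn_nprime // subrr
     expr0z maxxx.
pose d := denq x * denq y.
pose a := numq x * denq y; pose b := numq y * denq x.
have dx := denq_neq0 x; have dy := denq_neq0 y.
have a0 : a != 0 by rewrite mulf_neq0 // numq_eq0.
have b0 : b != 0 by rewrite mulf_neq0 // numq_eq0.
have d0 : d != 0 by rewrite mulf_neq0.
have xE : x = a%:~R / d%:~R.
  by rewrite -{1}(divq_num_den x) !intrM -mulf_div divff ?intr_eq0 // mulr1.
have yE : y = b%:~R / d%:~R.
  by rewrite -{1}(divq_num_den y) /b /d (mulrC (denq x)) !intrM -mulf_div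
     divff ?intr_eq0 // mulr1.
have zE : x + y = (a + b)%:~R / d%:~R by rewrite xE yE -mulrDl -intrD.
have ab0 : a + b != 0.
  by apply: contra_neq z0 => ab; rewrite zE ab mul0r.
rewrite zE xE yE !ratnorm_frac // le_max.
have p1 : 1 < (p%:R : rat) by rewrite ltr1n prime_gt1.
rewrite !ler_eXz2l // !lerD2l !lerN2 !lez_nat -!pfactor_dvdn ?absz_gt0 //.
have D k : (k <= logn p `|a| -> k <= logn p `|b| -> p ^ k %| `|(a + b)%R|)%N.
  rewrite -!pfactor_dvdn ?absz_gt0 // => ka kb.
  have -> : (p ^ k %| `|(a + b)%R|)%N = ((p ^ k)%N %| a + b)%Z by [].
  by rewrite rpredD.
have [l|/ltnW l] := leqP (logn p `|a|) (logn p `|b|).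
  by rewrite (D _ (leqnn _) l).
by rewrite (D _ l (leqnn _)) orbT.
Qed.

Lemma ratnormB x y : nrm (x - y) <= Num.max (nrm x) (nrm y).
Proof. by rewrite -[X in Num.max _ X]ratnormN ratnormD. Qed.

Lemma ratnorm_stable x y : nrm (x - y) < nrm y -> nrm x = nrm y.
Proof.
move=> h; apply/eqP; rewrite eq_le; apply/andP; split.
  by have := ratnormD (x - y) y; rewrite subrK (max_idPr (ltW h)).
have := ratnormB x (x - y); rewrite opprB addrC subrK le_max => /orP[//|].
by rewrite leNgt h.
Qed.

End RatNorm.

Definition cauchy_seq (p : nat) : pred (nat -> rat) := fun u =>
  `[< forall e : rat, 0 < e -> exists N, forall m n, (N <= m)%N -> (N <= n)%N ->
      ratnorm p (u m - u n) < e >].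

Definition null_seq (p : nat) (u : nat -> rat) : Prop :=
  forall e : rat, 0 < e -> exists N, forall n, (N <= n)%N -> ratnorm p (u n) < e.

Section CauchyRing.
Variable p : nat.

Lemma cauchy_seq_bounded (u : nat -> rat) : cauchy_seq p u ->
  exists2 B, 0 < B & exists N, forall n, (N <= n)%N -> ratnorm p (u n) <= B.
Proof.
move=> /asboolP/(_ 1 ltr01)[N h]; exists (Num.max 1 (ratnorm p (u N))).
  by rewrite lt_max ltr01.
exists N => n Nn; rewrite -(subrK (u N) (u n)).
apply: (le_trans (ratnormD _ _ _)); rewrite ge_max !le_max lexx orbT andbT.
by rewrite ltW // h.
Qed.

Fact cauchy_subring_closed : subring_closed (cauchy_seq p).
Proof.
split.
- by apply/asboolP => e e0; exists 0%N => m n _ _; rewrite subrr ratnorm0.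
- move=> u v /asboolP cu /asboolP cv; apply/asboolP => e e0.
  have [N hN] := cu e e0; have [M hM] := cv e e0.
  exists (maxn N M) => m n; rewrite !geq_max => /andP[Nm Mm] /andP[Nn Mn].
  rewrite !fctE opprD addrACA -opprD.
  apply: (le_lt_trans (ratnormB _ _ _)).
  by rewrite gt_max hN // hM.
- move=> u v cu cv; apply/asboolP => e e0.
  have [B B0 [Nb hB]] := cauchy_seq_bounded cu.
  have [C C0 [Nc hC]] := cauchy_seq_bounded cv.
  have [N hN] := asboolP _ cu (e / C) (divr_gt0 e0 C0).
  have [M hM] := asboolP _ cv (e / B) (divr_gt0 e0 B0).
  exists (maxn (maxn Nb Nc) (maxn N M)) => m n.
  rewrite !geq_max => /andP[/andP[b1 c1] /andP[n1 m1]].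
  move=> /andP[/andP[b2 c2] /andP[n2 m2]]; rewrite !fctE.
  have -> : u m * v m - u n * v n = u m * (v m - v n) + (u m - u n) * v n.
    by rewrite mulrBr mulrBl addrA subrK.
  apply: (le_lt_trans (ratnormD _ _ _)); rewrite gt_max !ratnormM; apply/andP; split.
    apply: (@le_lt_trans _ _ (B * ratnorm p (v m - v n))).
      by rewrite ler_wpM2r ?ratnorm_ge0 // hB.
    by rewrite mulrC -ltr_pdivlMr // hM.
  apply: (@le_lt_trans _ _ (ratnorm p (u m - u n) * C)).
    by rewrite ler_wpM2l ?ratnorm_ge0 // hC.
  by rewrite -ltr_pdivlMr // hN.
Qed.

HB.instance Definition _ :=
  GRing.isSubringClosed.Build (nat -> rat) (cauchy_seq p) cauchy_subring_closed.

Record cauchy := Cauchy { cauchy_val :> nat -> rat; _ : cauchy_seq p cauchy_val }.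

HB.instance Definition _ := [isSub for cauchy_val].
HB.instance Definition _ := [Choice of cauchy by <:].
HB.instance Definition _ := [SubChoice_isSubComNzRing of cauchy by <:].

Lemma cauchyP (u : cauchy) : cauchy_seq p u.
Proof. by case: u. Qed.

Definition null_ideal : pred cauchy := fun u => `[< null_seq p u >].

Lemma null_idealP (u : cauchy) : reflect (null_seq p u) (u \in null_ideal).
Proof. exact: asboolP. Qed.

Fact null_idealr_closed : idealr_closed null_ideal.
Proof.
split.
- by apply/null_idealP => e e0; exists 0%N => n _; rewrite ratnorm0.
- apply/null_idealP => /(_ 1 ltr01)[N /(_ N (leqnn N))].
  by rewrite /= ratnorm1 ltxx.
- move=> a u v /null_idealP nu /null_idealP nv; apply/null_idealP => e e0.
  have [B B0 [Nb hB]] := cauchy_seq_bounded (cauchyP a).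
  have [N hN] := nu (e / B) (divr_gt0 e0 B0).
  have [M hM] := nv e e0.
  exists (maxn Nb (maxn N M)) => n; rewrite !geq_max => /and3P[bn Nn Mn].
  apply: (le_lt_trans (ratnormD _ _ _)); rewrite gt_max hM // andbT ratnormM.
  apply: (@le_lt_trans _ _ (B * ratnorm p (u n))).
    by rewrite ler_wpM2r ?ratnorm_ge0 // hB.
  by rewrite mulrC -ltr_pdivlMr // hN.
Qed.

HB.instance Definition _ := isIdealr.Build cauchy null_ideal null_idealr_closed.

End CauchyRing.

Arguments null_ideal p u : clear implicits.

Definition null_idealr (p : nat) : idealr (cauchy p) :=
  Idealr.clone _ (null_ideal p) _.

Definition padic (p : nat) : Type := {ideal_quot (null_idealr p)}.

HB.instance Definition _ (p : nat) := GRing.ComNzRing.on (padic p).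
HB.instance Definition _ (p : nat) := EqQuotient.on (padic p).

Section PadicField.
Variable p : nat.
Local Open Scope quotient_scope.
Local Notation Q := (padic p).

Lemma padic_pi_eq0 (u : cauchy p) : (\pi_Q u == 0) = (u \in null_ideal p).
Proof. by rewrite -[0](rmorph0 (\pi_Q : cauchy p -> Q)) -Quotient.idealrBE subr0. Qed.

Lemma cauchy_eventually_const (u : cauchy p) : u \notin null_ideal p ->
  exists2 v, 0 < v & exists N, forall n, (N <= n)%N -> ratnorm p (u n) = v.
Proof.
move=> /null_idealP/existsNP[e /not_implyP[e0 /forallNP h]].
have [N hN] := asboolP _ (cauchyP u) e e0.
have /existsNP[m /not_implyP[Nm /negP]] := h N; rewrite -leNgt => em.
exists (ratnorm p (u m)); first exact: lt_le_trans em.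
exists N => n Nn; apply: ratnorm_stable.
by apply: (lt_le_trans _ em); exact: hN.
Qed.

Lemma padic_exists_inv (x : Q) : x != 0 -> exists y, y * x = 1.
Proof.
elim/quotW: x => u; rewrite padic_pi_eq0 => /cauchy_eventually_const[v v0 [N hN]].
pose w : nat -> rat := fun n => (u n)^-1.
have un n : (N <= n)%N -> u n != 0.
  by move=> Nn; rewrite -(ratnorm_gt0 p) hN.
have cw : cauchy_seq p w.
  apply/asboolP => e e0.
  have [M hM] := asboolP _ (cauchyP u) (e * (v * v)) (mulr_gt0 e0 (mulr_gt0 v0 v0)).
  exists (maxn N M) => m n; rewrite !geq_max => /andP[Nm Mm] /andP[Nn Mn].
  rewrite /w -(ltr_pM2r (mulr_gt0 v0 v0)) -{1}(hN _ Nm) -{1}(hN _ Nn) -!ratnormM.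
  have -> : ((u m)^-1 - (u n)^-1) * (u m * u n) = u n - u m.
    by rewrite mulrBl mulrA mulVf ?un // mul1r mulrCA mulVf ?un // mulr1.
  exact: hM.
exists (\pi_Q (Cauchy cw)); rewrite -rmorphM /= -[RHS](rmorph1 (\pi_Q : cauchy p -> Q)).
apply/eqP; rewrite -Quotient.idealrBE; apply/null_idealP => e e0.
exists N => n Nn; rewrite /= !fctE /w mulVf ?un // subrr ratnorm0 //.
Qed.

Definition padic_inv (x : Q) : Q := xget 0 [set y | y * x = 1].

Fact padic_mulVf (x : Q) : x != 0 -> padic_inv x * x = 1.
Proof. by move=> /padic_exists_inv; exact: (@xgetPex _ _ [set y | y * x = 1]). Qed.

Fact padic_invr0 : padic_inv 0 = 0.
Proof.
rewrite /padic_inv; case: xgetP => // y _ /eqP.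
by rewrite mulr0 eq_sym oner_eq0.
Qed.

HB.instance Definition _ :=
  GRing.ComNzRing_isField.Build (padic p) padic_mulVf padic_invr0.

(* |u n|_p is eventually constant unless u is a null sequence, for which the
   default value 0 is the limit (and the only possible eventual value). *)
Definition cauchy_norm (u : cauchy p) : rat :=
  xget 0 [set v | exists N, forall n, (N <= n)%N -> ratnorm p (u n) = v].

Definition padic_norm (x : Q) : rat := cauchy_norm (repr x).

Variant cauchy_norm_spec (u : cauchy p) : rat -> Prop :=
| CauchyNormNull of u \in null_ideal p : cauchy_norm_spec u 0
| CauchyNormConst v N of u \notin null_ideal p & 0 < v
    & (forall n, (N <= n)%N -> ratnorm p (u n) = v) : cauchy_norm_spec u v.

Lemma cauchy_normP (u : cauchy p) : cauchy_norm_spec u (cauchy_norm u).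
Proof.
have [nu|nu] := boolP (u \in null_ideal p).
  suff -> : cauchy_norm u = 0 by constructor.
  rewrite /cauchy_norm; case: xgetP => // v -> [N hN]; apply/eqP.
  rewrite eq_le -{2}(hN N) // ratnorm_ge0 andbT leNgt; apply/negP => v0.
  have /null_idealP/(_ _ v0)[M /(_ (maxn N M) (leq_maxr _ _))] := nu.
  by rewrite hN ?leq_maxl // ltxx.
have [v v0 [N hN]] := cauchy_eventually_const nu.
suff -> : cauchy_norm u = v by apply: CauchyNormConst hN.
apply: xget_unique; first by exists N.
move=> w [M hM]; rewrite -(hM (maxn N M)) ?leq_maxr // hN // leq_maxl //.
Qed.

Lemma padic_normE (u : cauchy p) : padic_norm (\pi_Q u) = cauchy_norm u.
Proof.
rewrite /padic_norm; set w := repr _.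
have uw : u - w \in null_ideal p by rewrite Quotient.idealrBE reprK.
case: (cauchy_normP u) => [nu|v N nu v0 hN].
  case: (cauchy_normP w) => // v N.
  by rewrite -[w in w \notin _](subKr u) rpredB.
case: (cauchy_normP w) => [nw|w' M _ _ hM].
  by rewrite -(subrK w u) rpredD in nu.
have /null_idealP/(_ _ v0)[K hK] := uw.
pose n := maxn N (maxn M K).
have [Nn Mn Kn] : [/\ (N <= n)%N, (M <= n)%N & (K <= n)%N].
  by split; rewrite !leq_max leqnn ?orbT.
rewrite -(hM n) // -(hN n) //; apply: ratnorm_stable.
by rewrite -opprB ratnormN hN // hK.
Qed.

Lemma padic_norm0 : padic_norm 0 = 0.
Proof.
rewrite -[0](rmorph0 (\pi_Q : cauchy p -> Q)) padic_normE.
by case: cauchy_normP => // v N; rewrite rpred0.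
Qed.

Lemma padic_norm_eq0 (x : Q) : (padic_norm x == 0) = (x == 0).
Proof.
elim/quotW: x => u; rewrite padic_normE padic_pi_eq0.
by case: cauchy_normP => [->|v N /negbTE -> /gt_eqF]; rewrite ?eqxx.
Qed.

Lemma padic_normN (x : Q) : padic_norm (- x) = padic_norm x.
Proof.
elim/quotW: x => u; rewrite -rmorphN !padic_normE; congr (xget _ _).
by apply/funext => v /=; apply/propext; split => -[N h]; exists N => n /h;
  rewrite ratnormN.
Qed.

Lemma padic_normM (x y : Q) : padic_norm (x * y) = padic_norm x * padic_norm y.
Proof.
have [->|] := eqVneq x 0; first by rewrite mul0r padic_norm0 mul0r.
have [->|] := eqVneq y 0; first by rewrite mulr0 padic_norm0 mulr0.
elim/quotW: x => u; elim/quotW: y => w; rewrite -rmorphM !padic_normE.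
rewrite !padic_pi_eq0 => nw nu.
case: (cauchy_normP u) nu => [->//|v N _ v0 hN _].
case: (cauchy_normP w) nw => [->//|v' M _ v0' hM _].
apply: xget_unique => [|t [K hK]].
  by exists (maxn N M) => n; rewrite geq_max => /andP[? ?]; rewrite ratnormM hN ?hM.
pose n := maxn N (maxn M K).
have [Nn Mn Kn] : [/\ (N <= n)%N, (M <= n)%N & (K <= n)%N].
  by split; rewrite !leq_max leqnn ?orbT.
by rewrite -(hK n) // ratnormM hN ?hM.
Qed.

Lemma padic_normD (x y : Q) :
  padic_norm (x + y) <= Num.max (padic_norm x) (padic_norm y).
Proof.
elim/quotW: x => u; elim/quotW: y => w; rewrite -rmorphD !padic_normE.
case: (cauchy_normP (u + w)) => [_|t K _ t0 hK].
  rewrite le_max.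
  by case: (cauchy_normP u) => [_|v N _ /ltW ->//]; rewrite lexx.
pose small (z : cauchy p) := exists N, forall n, (N <= n)%N ->
  ratnorm p (z n) < t.
have P z : cauchy_norm z < t -> small z.
  case: cauchy_normP => [/null_idealP/(_ _ t0)//|v N _ _ hN vt].
  by exists N => n /hN ->.
rewrite leNgt; apply/negP; rewrite gt_max => /andP[/P[N hN] /P[M hM]].
pose n := maxn N (maxn M K).
have [Nn Mn Kn] : [/\ (N <= n)%N, (M <= n)%N & (K <= n)%N].
  by split; rewrite !leq_max leqnn ?orbT.
have := ratnormD p (u n) (w n); rewrite -[u n + w n]/((u + w) n) (hK n) //.
by rewrite leNgt gt_max hN ?hM.
Qed.

Definition padic_dist (x y : Q) : rat := padic_norm (x - y).

Fact padic_distxx (x : Q) : padic_dist x x = 0.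
Proof. by rewrite /padic_dist subrr padic_norm0. Qed.

Fact padic_dist_eq0 (x y : Q) : padic_dist x y = 0 -> x = y.
Proof. by move=> /eqP; rewrite padic_norm_eq0 subr_eq0 => /eqP. Qed.

Fact padic_dist_sym (x y : Q) : padic_dist x y = padic_dist y x.
Proof. by rewrite /padic_dist -opprB padic_normN. Qed.

Lemma padic_norm_ge0 (x : Q) : 0 <= padic_norm x.
Proof. by rewrite /padic_norm; case: cauchy_normP => // v N _ /ltW. Qed.

Fact padic_dist_triangle (y x z : Q) :
  padic_dist x z <= padic_dist x y + padic_dist y z.
Proof.
have -> : padic_dist x z = padic_norm ((x - y) + (y - z)) by rewrite addrA subrK.
apply: (le_trans (padic_normD _ _)).
by rewrite ge_max lerDl lerDr !padic_norm_ge0.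
Qed.

HB.instance Definition _ := isMetric.Build rat (padic p)
  padic_distxx padic_dist_eq0 padic_dist_sym padic_dist_triangle.

Definition cauchy_cst (q : rat) : cauchy p.
Proof.
apply: (@Cauchy p (fun=> q)).
by apply/asboolP => e e0; exists 0%N => m n _ _; rewrite subrr ratnorm0.
Defined.

Lemma padic_intE (n : int) : n%:~R = \pi_Q (cauchy_cst n%:~R).
Proof.
rewrite -[LHS](rmorph_int (\pi_Q : cauchy p -> Q)); congr (\pi_Q _).
apply/val_inj/funext => k /=.
have E (m : nat) : (m%:R : cauchy p) k = m%:R.
  by elim: m => [//|m IH]; rewrite -natr1 -[m.+1%:R]natr1 -IH.
by case: n => m; [exact: E | exact: (congr1 -%R (E m.+1))].
Qed.

Lemma padic_norm_cst (q : rat) : padic_norm (\pi_Q (cauchy_cst q)) = ratnorm p q.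
Proof.
rewrite padic_normE; apply: xget_unique; first by exists 0%N.
by move=> v [N /(_ N (leqnn N))].
Qed.

Lemma padic_norm_int (n : int) : padic_norm (n%:~R) = ratnorm p n%:~R.
Proof. by rewrite padic_intE padic_norm_cst. Qed.

Lemma padic_rat_dense (x : Q) (e : rat) : 0 < e ->
  exists n d : int, d%:~R != 0 :> Q /\ padic_norm (x - n%:~R / d%:~R) < e.
Proof.
elim/quotW: x => u e0; have [N hN] := asboolP _ (cauchyP u) e e0.
pose q := u N; exists (numq q), (denq q).
have d0 : (denq q)%:~R != 0 :> Q.
  by rewrite -padic_norm_eq0 padic_norm_int ratnorm_eq0 intr_eq0 denq_neq0.
split=> //; suff -> : (numq q)%:~R / (denq q)%:~R = \pi_Q (cauchy_cst q).
  rewrite -rmorphB padic_normE; case: cauchy_normP => // v M _ _ hM.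
  rewrite -(hM (maxn N M)) ?leq_maxr //; apply: hN => //; exact: leq_maxl.
apply: (canLR (mulfK d0)); rewrite !padic_intE -rmorphM; congr (\pi_Q _).
by apply/val_inj/funext => k; rewrite /= numqE.
Qed.

End PadicField.

Lemma padic_denseP (p : nat) (S : set (padic p)) :
  dense S <-> forall (x : padic p) (e : rat), 0 < e ->
    exists2 y, S y & padic_norm (x - y) < e.
Proof.
have ballE (x : padic p) (e : rat) : ball x e = [set y | padic_norm (x - y) < e].
  exact: ballEmdist.
split=> [dS x e e0|dS U [x Ux] oU].
  have [|y [/interior_subset]] := dS (interior (ball x e)) _ (open_interior _).
    by exists x; exact: nbhsx_ballx.
  by rewrite ballE => ? ?; exists y.
have /nbhs_ballP[e /= e0 eU] := open_nbhs_nbhs (conj oU Ux).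
have [y Sy xy] := dS x e e0; exists y; split => //; apply: eU.
by rewrite ballE.
Qed.

Definition quotient_set (F : fieldType) (x : nat -> int) : set F :=
  [set z | exists m n : nat, x n <> 0 /\ z = (x m)%:~R / (x n)%:~R].

Arguments quotient_set F x : clear implicits.

(* Main.v *)
(* Sampled along the exponents n = (p - 1) p^r s, where p-adic units have powers
   congruent to 1 modulo p^(r+1), a suitable integer multiple w of the sequence
   satisfies w(s + p^k j) = w(s) + p^(k+e) U j modulo p^(k+e+1) with U prime to p
   and e fixed. Lifting digit by digit as in Hensel's lemma, w comes arbitrarily
   close to every element of p^e Z_p, and quotients of such elements fill Q_p.
   The explicit solutions of the recurrence give the congruence in both cases.
   Conversely, for a triple root with x_0 = 0 and 4 a x_1 = x_2, the solution is
   a constant times a^n n^2, so all quotients have even p-adic valuation and stay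
   away from p. *)
Require Import Defs.
From HB Require Import structures.
From mathcomp Require Import all_boot all_order all_algebra.
From mathcomp Require Import cyclic.
From mathcomp Require Import boolp classical_sets functions topology.
From mathcomp Require Import ring zify.

Set Implicit Arguments.
Unset Strict Implicit.
Unset Printing Implicit Defensive.

Import Order.TTheory GRing.Theory Num.Theory.

Local Open Scope ring_scope.

(** * Norms of integers in the p-adic field, and a density criterion for quotient sets *)

Lemma subr_fracE (F : fieldType) (n d m l : F) : d != 0 -> l != 0 ->
  - (n / d) + (n * l - m * d) / (d * l) = - (m / l).
Proof. by move=> d0 l0; field; rewrite d0 l0. Qed.

Section PadicNorm.
Variable p : nat.
Hypothesis hp : prime p.

Let p0 : 0 < (p%:R : rat). Proof. by rewrite ltr0n prime_gt0. Qed.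

Lemma padic_norm_div (x y : padic p) : y != 0 ->
  padic_norm (x / y) = padic_norm x / padic_norm y.
Proof.
move=> y0; apply: (canRL (mulfK _)); first by rewrite padic_norm_eq0.
by rewrite -padic_normM divfK.
Qed.

Lemma padic_norm_stable (x y : padic p) :
  padic_norm (y - x) < padic_norm y -> padic_norm x = padic_norm y.
Proof.
move=> h; apply/eqP; rewrite eq_le; apply/andP; split.
  have := padic_normD (x - y) y; rewrite subrK -opprB padic_normN.
  by rewrite (max_idPr (ltW h)).
have := padic_normD (y - x) x; rewrite subrK le_max => /orP[|//].
by rewrite leNgt h.
Qed.

Lemma padic_intr_eq0 (n : int) : (n%:~R == 0 :> padic p) = (n == 0).
Proof. by rewrite -padic_norm_eq0 padic_norm_int ratnorm_eq0 intr_eq0. Qed.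

Lemma ratnorm_int (z : int) : z != 0 ->
  ratnorm p z%:~R = p%:R ^- logn p `|z|%N.
Proof.
move=> z0; rewrite -[z%:~R]divr1 -[1]/(1%:~R) ratnorm_frac // logn1 sub0r.
by rewrite -exprnN.
Qed.

Lemma ratnorm_dvdz (k : nat) (z : int) : ((p ^ k)%N%:Z %| z)%Z ->
  ratnorm p z%:~R <= p%:R ^- k.
Proof.
have [-> _|z0] := eqVneq z 0; first by rewrite ratnorm0 invr_ge0 exprn_ge0 // ltW.
rewrite dvdzE /= pfactor_dvdn ?absz_gt0 // => h.
rewrite ratnorm_int // lef_pV2 ?posrE ?exprn_gt0 //.
by rewrite ler_weXn2l // ler1n prime_gt0.
Qed.

Lemma ratnorm_pexp (k : nat) : ratnorm p (p ^ k)%N%:R = p%:R ^- k.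
Proof.
rewrite -[(p ^ k)%N%:R]/((p ^ k)%N%:Z%:~R) ratnorm_int ?pfactorK //.
by rewrite -lt0n expn_gt0 prime_gt0.
Qed.

Lemma pexp_small (e : rat) : 0 < e -> exists L, forall n, (L <= n)%N -> p%:R ^- n < e.
Proof.
move=> e0; exists (Num.bound e^-1) => n hn.
rewrite invf_plt ?posrE ?exprn_gt0 //.
have ei0 : 0 <= e^-1 by rewrite invr_ge0 ltW.
apply: (lt_trans (archi_boundP ei0)).
rewrite -natrX ltr_nat; apply: (leq_ltn_trans hn).
exact: ltn_expl (prime_gt1 hp).
Qed.

End PadicNorm.

(** An approximation of [n / d] is obtained from values of [w] close to [p ^ e * n] and [p ^ e * d].
    The scale [C] cancels in the quotient, so it may be divisible by [p]. *)
Lemma dense_quotient_set (p : nat) (hp : prime p) (x : nat -> int) (w : nat -> int)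
    (f : nat -> nat) (C : int) (e : nat) :
  C != 0 -> (forall s, w s = C * x (f s)) ->
  (forall (t : int) L, ((p ^ e)%N%:Z %| t)%Z ->
     exists s, ((p ^ (L + e))%N%:Z %| w s - t)%Z) ->
  dense (quotient_set (padic p) x).
Proof.
move=> C0 wE hit; apply/padic_denseP => z eps eps0.
have [n [d [d0 hz]]] := padic_rat_dense z eps0.
have dz : d != 0 by rewrite padic_intr_eq0 in d0.
have Nd : 0 < ratnorm p d%:~R by rewrite ratnorm_gt0 intr_eq0.
have pe : 0 < (p%:R ^- e : rat) by rewrite invr_gt0 exprn_gt0 // ltr0n prime_gt0.
(* [L1] forces [w l] to have the norm of [p ^ e * d]. [L2] bounds the cross difference
   [n * w l - w m * d] relative to [d * w l], whose norm contains that of [d] twice. *)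
have [L1 hL1] := pexp_small hp Nd.
have [L2 hL2] := pexp_small hp (mulr_gt0 eps0 (mulr_gt0 Nd Nd)).
pose L := maxn L1 L2.
have [m hm] := hit ((p ^ e)%N%:Z * n) L (dvdz_mulr _ (dvdzz _)).
have [l hl] := hit ((p ^ e)%N%:Z * d) L (dvdz_mulr _ (dvdzz _)).
have Nwl : ratnorm p (w l)%:~R = p%:R ^- e * ratnorm p d%:~R.
  rewrite -(ratnorm_pexp hp) -ratnormM; apply: ratnorm_stable.
  rewrite -[(p ^ e)%N%:R]/((p ^ e)%N%:Z%:~R) -intrM -intrB.
  apply: (le_lt_trans (ratnorm_dvdz hp hl)).
  rewrite intrM ratnormM [ratnorm _ (_%:~R)](ratnorm_pexp hp) exprD invfM mulrC.
  by rewrite ltr_pM2l // hL1 // leq_maxl.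
have wl0 : w l != 0.
  by rewrite -(@intr_eq0 rat) -(ratnorm_gt0 p) Nwl mulr_gt0.
exists ((w m)%:~R / (w l)%:~R).
  exists (f m), (f l); move: wl0; rewrite !wE mulf_eq0 negb_or => /andP[_ xl0].
  split; first exact/eqP.
  by rewrite !intrM -mulf_div divff ?mul1r // padic_intr_eq0.
have -> : z - (w m)%:~R / (w l)%:~R =
    (z - n%:~R / d%:~R) + (n * w l - w m * d)%:~R / (d * w l)%:~R.
  rewrite intrB !intrM -addrA; congr (_ + _).
  apply/esym/subr_fracE => //.
  by rewrite padic_intr_eq0.
apply: (le_lt_trans (padic_normD _ _)); rewrite gt_max hz /=.
rewrite padic_norm_div ?padic_intr_eq0 ?mulf_neq0 // !padic_norm_int.
rewrite [X in _ / ratnorm _ X]intrM ratnormM Nwl.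
have hN : ((p ^ (L + e))%N%:Z %| n * w l - w m * d)%Z.
  have -> : n * w l - w m * d =
    n * (w l - (p ^ e)%N%:Z * d) - (w m - (p ^ e)%N%:Z * n) * d by ring.
  by apply: rpredB; [exact: dvdz_mull | exact: dvdz_mulr].
rewrite ltr_pdivrMr ?mulr_gt0 //; apply: (le_lt_trans (ratnorm_dvdz hp hN)).
rewrite exprD invfM mulrC.
have -> : eps * (ratnorm p d%:~R * (p%:R ^- e * ratnorm p d%:~R)) =
   p%:R ^- e * (eps * (ratnorm p d%:~R * ratnorm p d%:~R)) by ring.
by rewrite ltr_pM2l // hL2 // leq_maxr.
Qed.

(** * Digit-by-digit lifting, and periodicity of powers modulo powers of p *)

Section Hensel.
Variable p : nat.
Hypothesis hp : prime p.

Lemma dvdz_primeM (u v : int) :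
  ~ (p%:Z %| u)%Z -> ~ (p%:Z %| v)%Z -> ~ (p%:Z %| u * v)%Z.
Proof. by rewrite !dvdzE /= abszM Euclid_dvdM // => /negP/negbTE-> /negP/negbTE->. Qed.

Lemma dvdz_primeX (u : int) n : ~ (p%:Z %| u)%Z -> ~ (p%:Z %| u ^+ n)%Z.
Proof.
move=> hu; elim: n => [|n IH]; last by rewrite exprS; exact: dvdz_primeM.
by rewrite expr0 dvdzE /= Euclid_dvd1.
Qed.

Lemma logn_ndvdz (z : int) : ~ (p%:Z %| z)%Z -> logn p `|z|%N = 0%N.
Proof. by rewrite dvdzE /= lognE => /negP/negbTE ->; rewrite !andbF. Qed.

Lemma dvdz_prime_pred : ~ (p%:Z %| p%:Z - 1)%Z.
Proof.
rewrite (rpredBl _ (dvdzz _)).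
by rewrite dvdzE /= Euclid_dvd1.
Qed.

Lemma solve_linear_modp (U c : int) : ~ (p%:Z %| U)%Z ->
  exists j : nat, (p%:Z %| c + U * j%:Z)%Z.
Proof.
move=> hU; have cop : coprimez U p%:Z.
  by rewrite coprimezE /= coprime_sym prime_coprime //; apply/negP.
have [[u v] /= huv] := coprimezP _ _ cop.
(* The Bezout coefficient [u] inverts [U] modulo [p]; reducing [- c * u] makes it nonnegative, as
   the index [j] must be. *)
pose r := ((- c * u) %% p%:Z)%Z.
have r0 : 0 <= r by rewrite modz_ge0 // -lt0n prime_gt0.
exists `|r|%N; rewrite gez0_abs //.
have rE := divz_eq (- c * u) p%:Z; rewrite -/r in rE.
apply/dvdzP; exists (c * v - U * (- c * u %/ p)%Z).
have -> : r = - ((- c * u %/ p)%Z * p) + - c * u by rewrite [X in _ + X]rE addKr.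
have {1}-> : c = c * (u * U + v * p%:Z) by rewrite huv mulr1.
ring.
Qed.

(** If [w s - t = c * p ^ (k + e)], moving [s] by [p ^ k * j] adds [U * j] to [c] modulo [p], and a
    suitable [j] cancels this digit. The lifting starts at [s = 0]. *)
Lemma hensel_hit (w : nat -> int) (e : nat) :
  ((p ^ e)%N%:Z %| w 0%N)%Z ->
  (forall s k, exists2 U : int, ~ (p%:Z %| U)%Z & forall j,
     ((p ^ (k + e).+1)%N%:Z %|
       w (s + p ^ k * j)%N - w s - (p ^ (k + e))%N%:Z * U * j%:Z)%Z) ->
  forall (t : int) L, ((p ^ e)%N%:Z %| t)%Z ->
    exists s, ((p ^ (L + e))%N%:Z %| w s - t)%Z.
Proof.
move=> w0 hw t L ht; elim: L => [|k [s /dvdzP[c hc]]].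
  by exists 0%N; rewrite rpredB.
have [U hU hs] := hw s k; have [j /dvdzP[q hq]] := solve_linear_modp c hU.
exists (s + p ^ k * j)%N; rewrite addSn.
have -> : w (s + p ^ k * j)%N - t =
  (w (s + p ^ k * j)%N - w s - (p ^ (k + e))%N%:Z * U * j%:Z)
  + (p ^ (k + e))%N%:Z * (c + U * j%:Z) by rewrite -[w s](subrK t) hc; ring.
by rewrite rpredD // hq expnS PoszM mulrCA [p%:Z * _]mulrC dvdz_mull.
Qed.

Lemma euler_pexp (a : int) n : ~ (p%:Z %| a)%Z ->
  ((p ^ n.+1)%N%:Z %| a ^+ (p.-1 * p ^ n) - 1)%Z.
Proof.
move=> ha; set m := (p ^ n.+1)%N.
have m0 : (m%:Z != 0) by rewrite -lt0n expn_gt0 prime_gt0.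
(* Euler's theorem is applied to a natural number, the residue of [a]; the totient of [p ^ n.+1] is
   [p.-1 * p ^ n]. *)
rewrite -eqz_mod_dvd -modzXm.
have r0 : 0 <= (a %% m)%Z by rewrite modz_ge0.
rewrite -[(a %% m)%Z]gez0_abs //.
have cop : coprime `|(a %% m)%Z|%N m.
  rewrite coprime_pexpr // coprime_sym prime_coprime //; apply/negP => h; apply: ha.
  rewrite (divz_eq a m%:Z) rpredD // dvdz_mull // dvdzE /=.
  exact: dvdn_exp.
have := Euler_exp_totient cop; rewrite totient_pfactor //= => h.
by rewrite -rmorphXn /= -[1]/(1%N%:Z) !modz_nat h.
Qed.

(** Along such exponents the powers in the closed forms act as constants, leaving only the
    polynomial factors to vary. *)
Lemma dvdz_expB_period (a : int) r k n j : ~ (p%:Z %| a)%Z ->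
  ((p ^ (r + k).+1)%N%:Z %| a ^+ (n + p.-1 * p ^ (r + k) * j) - a ^+ n)%Z.
Proof.
move=> ha; rewrite exprD -[X in _ - X]mulr1 -mulrBr dvdz_mull // exprM.
by rewrite -(expr1n _ j) subrXX dvdz_mulr // euler_pexp.
Qed.

End Hensel.

(** * Closed forms for cubic recurrences with a repeated root *)

Lemma nat_ind3 (P : nat -> Prop) : P 0%N -> P 1%N -> P 2%N ->
  (forall n, P n -> P n.+1 -> P n.+2 -> P n.+3) -> forall n, P n.
Proof.
move=> P0 P1 P2 IH n; suff [] : [/\ P n, P n.+1 & P n.+2] by [].
by elim: n => [//|n [h0 h1 h2]]; split=> //; exact: IH.
Qed.

Section CubicRecurrence.
Variable (x : nat -> int).

(** A solution is [a ^+ n] times a quadratic in [n]; the factor [2 * a ^+ 2] clears the denominators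
    of its coefficients. *)
Lemma triple_root_formula (a : int) :
  (forall n, x n.+3 = 3 * a * x n.+2 - 3 * a ^+ 2 * x n.+1 + a ^+ 3 * x n) ->
  forall n, 2 * a ^+ 2 * x n = a ^+ n * (2 * a ^+ 2 * x 0%N
    + (4 * a * x 1%N - x 2%N - 3 * a ^+ 2 * x 0%N) * n%:Z
    + (x 2%N - 2 * a * x 1%N + a ^+ 2 * x 0%N) * n%:Z ^+ 2).
Proof.
move=> rec n; elim/nat_ind3: n => [|||n h0 h1 h2]; try by ring.
rewrite rec.
have -> : 2 * a ^+ 2 * (3 * a * x n.+2 - 3 * a ^+ 2 * x n.+1 + a ^+ 3 * x n)
  = 3 * a * (2 * a ^+ 2 * x n.+2) - 3 * a ^+ 2 * (2 * a ^+ 2 * x n.+1)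
    + a ^+ 3 * (2 * a ^+ 2 * x n) by ring.
rewrite h0 h1 h2 !exprS; ring.
Qed.

(** With S the shift, [G] is (S - a)^2 applied to [x] at 0, which isolates the coefficient of
    [b ^+ n]; [H] is (S - a)(S - b), which isolates that of [n * a ^+ n]. *)
Lemma double_root_formula (a b : int) :
  (forall n, x n.+3 = (2 * a + b) * x n.+2 - (a ^+ 2 + 2 * a * b) * x n.+1
                      + a ^+ 2 * b * x n) ->
  let G := x 2%N - 2 * a * x 1%N + a ^+ 2 * x 0%N in
  let H := x 2%N - x 1%N * (a + b) + x 0%N * a * b in
  forall n, a * (a - b) ^+ 2 * x n =
    a ^+ n * (a * (a - b) ^+ 2 * x 0%N - a * G + (a - b) * H * n%:Z)
    + a * G * b ^+ n.
Proof.
move=> rec G H n; set C := a * (a - b) ^+ 2.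
elim/nat_ind3: n => [|||n h0 h1 h2]; try by rewrite /C /G /H; ring.
rewrite rec.
have -> : C * ((2 * a + b) * x n.+2 - (a ^+ 2 + 2 * a * b) * x n.+1 + a ^+ 2 * b * x n)
  = (2 * a + b) * (C * x n.+2) - (a ^+ 2 + 2 * a * b) * (C * x n.+1)
    + a ^+ 2 * b * (C * x n) by ring.
rewrite h0 h1 h2 !exprS; ring.
Qed.

(** * Density, or its failure, read off the closed forms *)

Variable p : nat.
Hypothesis hp : prime p.

(** Write [D = D' * p ^ d]. At [f s] the linear term is [p ^ d.*2.+1 * D' * (p - 1) * s], while the
    quadratic term carries one more factor [p]. Hence the exponent [d.*2.+1] for [e], and the
    condition on [P], which is the value of [w] at 0. *)
Lemma dense_of_quadratic_formula (C a P D E : int) :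
  C != 0 -> ~ (p%:Z %| a)%Z -> D != 0 ->
  ((p ^ (logn p `|D|).*2.+1)%N%:Z %| P)%Z ->
  (forall n, C * x n = a ^+ n * (P + D * n%:Z + E * n%:Z ^+ 2)) ->
  dense (quotient_set (padic p) x).
Proof.
move=> C0 ha D0; set d := logn p `|D|%N => hP hx.
have /dvdzP[D' DE] : ((p ^ d)%N%:Z %| D)%Z.
  by rewrite dvdzE /= pfactor_dvdn ?absz_gt0.
have hD' : ~ (p%:Z %| D')%Z.
  move=> /dvdzP[q qE].
  have : ((p ^ d.+1)%N%:Z %| D)%Z.
    by rewrite DE qE expnS PoszM -mulrA dvdz_mull.
  by rewrite dvdzE /= pfactor_dvdn ?absz_gt0 // ltnn.
have ppredE : p.-1%:Z = p%:Z - 1 by rewrite predn_int ?prime_gt0.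
pose f s := (p.-1 * p ^ d.+1 * s)%N.
apply: (@dense_quotient_set p hp x (fun s => C * x (f s)) f C d.*2.+1) => //.
apply: (hensel_hit hp).
  by rewrite hx /f muln0 expr0 mul1r mulr0 expr0n mulr0 !addr0.
move=> s k; exists (a ^+ f s * (p%:Z - 1) * D').
  apply: dvdz_primeM => //; apply: dvdz_primeM => //; last exact: dvdz_prime_pred.
  exact: dvdz_primeX.
move=> j; rewrite !hx.
have fE : f (s + p ^ k * j)%N = (f s + p.-1 * p ^ (d.+1 + k) * j)%N.
  by rewrite /f mulnDr expnD !mulnA.
have [q hq] := dvdzP (dvdz_expB_period hp d.+1 k (f s) j ha).
rewrite -fE in hq.
have fz t : (f t)%:Z = (p%:Z - 1) * p%:Z * (p ^ d)%N%:Z * t%:Z.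
  by rewrite /f expnS !PoszM ppredE; ring.
have [P' PE] := dvdzP hP.
have expE : (p ^ (k + d.*2.+1).+1)%N%:Z = p%:Z * p%:Z * (p ^ k)%N%:Z * (p ^ d)%N%:Z ^+ 2.
  by rewrite -addnn addnS !expnS !expnD !PoszM; ring.
have expE' : (p ^ (k + d.*2.+1))%N%:Z = p%:Z * (p ^ k)%N%:Z * (p ^ d)%N%:Z ^+ 2.
  by rewrite -addnn addnS !expnS !expnD !PoszM; ring.
have expE2 : (p ^ d.*2.+1)%N%:Z = p%:Z * (p ^ d)%N%:Z ^+ 2.
  by rewrite -addnn !expnS !expnD !PoszM; ring.
have expE3 : (p ^ (d.+1 + k).+1)%N%:Z = p%:Z * p%:Z * (p ^ k)%N%:Z * (p ^ d)%N%:Z.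
  by rewrite addSn !expnS !expnD !PoszM; ring.
rewrite expE expE'; rewrite expE2 in PE; rewrite expE3 in hq.
move/(canRL (subrK _)): hq => ->.
rewrite !fz PE DE PoszD PoszM.
set A := a ^+ f s; set pk := Posz (p ^ k); set pd := Posz (p ^ d).
(* The part with [q] comes from the change of [a ^+ f s], the rest from the increment of the square;
   the linear increment is exactly what is subtracted. *)
apply/dvdzP; exists (q * pd * (P' * p%:Z + D' * (p%:Z - 1) * p%:Z * (s%:Z + pk * j%:Z)
   + E * (p%:Z - 1) ^+ 2 * p%:Z ^+ 2 * (s%:Z + pk * j%:Z) ^+ 2)
   + A * (p%:Z - 1) ^+ 2 * j%:Z * E * (2 * s%:Z + pk * j%:Z)).
ring.
Qed.

(** For a step [p ^ k * j] of [s], both powers are constant modulo [p ^ k.+1], so only the term in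
    [Q] moves the value and [e = 0] suffices. *)
Lemma dense_of_linear_formula (C a b P Q R : int) :
  C != 0 -> ~ (p%:Z %| a)%Z -> ~ (p%:Z %| b)%Z -> ~ (p%:Z %| Q)%Z ->
  (forall n, C * x n = a ^+ n * (P + Q * n%:Z) + R * b ^+ n) ->
  dense (quotient_set (padic p) x).
Proof.
move=> C0 ha hb hQ hx.
have ppredE : p.-1%:Z = p%:Z - 1 by rewrite predn_int ?prime_gt0.
pose f s := (p.-1 * s)%N.
apply: (@dense_quotient_set p hp x (fun s => C * x (f s)) f C 0) => //.
apply: (hensel_hit hp); first by rewrite expn0 dvd1z.
move=> s k; exists (a ^+ f s * (p%:Z - 1) * Q).
  apply: dvdz_primeM => //; apply: dvdz_primeM => //; last exact: dvdz_prime_pred.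
  exact: dvdz_primeX.
move=> j; rewrite !hx addn0.
have fE : f (s + p ^ k * j)%N = (f s + p.-1 * p ^ (0 + k) * j)%N.
  by rewrite /f mulnDr !mulnA.
have [q hq] := dvdzP (dvdz_expB_period hp 0 k (f s) j ha).
have [r hr] := dvdzP (dvdz_expB_period hp 0 k (f s) j hb).
rewrite -fE add0n in hq hr.
have fz t : (f t)%:Z = (p%:Z - 1) * t%:Z by rewrite /f PoszM ppredE.
move/(canRL (subrK _)): hq => ->; move/(canRL (subrK _)): hr => ->.
rewrite !fz PoszD PoszM expnS PoszM.
set A := a ^+ f s; set B := b ^+ f s; set pk := Posz (p ^ k).
apply/dvdzP; exists (q * (P + Q * (p%:Z - 1) * (s%:Z + pk * j%:Z)) + R * r).
ring.
Qed.

(** The valuations of all nonzero terms have the same parity, so a nonzero quotient has even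
    valuation and cannot be close to [p]. *)
Lemma not_dense_of_square_formula (C a E : int) :
  C != 0 -> ~ (p%:Z %| a)%Z ->
  (forall n, C * x n = a ^+ n * (E * n%:Z ^+ 2)) ->
  ~ dense (quotient_set (padic p) x).
Proof.
move=> C0 ha hx /padic_denseP dn.
have p0 : 0 < (p%:R : rat) by rewrite ltr0n prime_gt0.
have a0 : a != 0 by apply/eqP => a0; apply: ha; rewrite a0 dvdz0.
have logx n : x n != 0 ->
    exists l, (logn p `|x n| + logn p `|C| = logn p `|E| + l.*2)%N.
  move=> xn0; exists (logn p n).
  have := mulf_neq0 C0 xn0; rewrite hx expr2 !mulf_eq0 !negb_or.
  move=> /and4P[an0 E0 n0 _].
  have := congr1 (fun z : int => logn p `|z|%N) (hx n).
  rewrite expr2 !abszM !lognM ?muln_gt0 ?absz_gt0 ?an0 ?E0 ?n0 // addnn addnC.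
  by rewrite (logn_ndvdz (dvdz_primeX hp ha)).
have pinv : 0 < (p%:R^-1 : rat) by rewrite invr_gt0.
(* The radius is the norm of [p] itself, so the strict inequality forces the quotient to have norm
   exactly [p%:R^-1]. *)
have [_ [m [n [/eqP xn0 ->]]] hmn] := dn p%:Z%:~R p%:R^-1 pinv.
have Np : padic_norm (p%:Z%:~R : padic p) = p%:R^-1.
  by rewrite padic_norm_int ratnorm_int /= ?logn_prime ?eqxx ?expr1 // -lt0n prime_gt0.
have xn0' : (x n)%:~R != 0 :> padic p by rewrite padic_intr_eq0.
have Nq : padic_norm ((x m)%:~R / (x n)%:~R : padic p) = p%:R^-1.
  by rewrite -Np; apply: padic_norm_stable; rewrite Np.
have xm0 : x m != 0.
  apply: contra_eq_neq Nq => ->; rewrite mul0r padic_norm0 eq_sym gt_eqF //.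
move: Nq; rewrite padic_norm_div // !padic_norm_int !ratnorm_int //.
have [l hl] := logx m xm0; have [l' hl'] := logx n xn0.
(* Comparing exponents, the valuation of [x m] exceeds that of [x n] by 1, against [hl] and
   [hl']. *)
move/(canRL (mulfVK _)); rewrite invr_eq0 expf_eq0 (gt_eqF p0) andbF => /(_ isT).
rewrite -invfM -exprS => /invr_inj.
move/(ieexprIn p0); rewrite pnatr_eq1 => h.
have {}h := h (negbT (gtn_eqF (prime_gt1 hp))); lia.
Qed.

End CubicRecurrence.

(** * Coefficients in terms of the roots, and assembly of the cases *)

Lemma cubic_vieta (b1 b2 b3 a b c : int) :
  'X^3 - b1 *: 'X^2 - b2 *: 'X - b3%:P
    = ('X - a%:P) * ('X - b%:P) * ('X - c%:P) :> {poly int} ->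
  [/\ b1 = a + b + c, b2 = - (a * b + b * c + c * a) & b3 = a * b * c].
Proof.
move=> h.
have ev t : t ^+ 3 - b1 * t ^+ 2 - b2 * t - b3 = (t - a) * (t - b) * (t - c).
  have := congr1 (fun q : {poly int} => q.[t]) h.
  by rewrite !(hornerM, hornerD, hornerN, hornerZ, hornerXn, hornerX, hornerC).
(* Three values give three linear equations that determine the three coefficients. *)
have h0 := ev 0; have h1 := ev 1; have h2 := ev (-1).
by split; lia.
Qed.

Theorem theorem1p4 (x : nat -> int) (b1 b2 b3 a b c : int) (p : nat)
    (hrec : forall n : nat, (3 <= n)%N ->
      x n = b1 * x (n - 1)%N + b2 * x (n - 2)%N + b3 * x (n - 3)%N)
    (hb3 : b3 <> 0)
    (hchar : 'X^3 - b1 *: 'X^2 - b2 *: 'X - b3%:P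
             = ('X - a%:P) * ('X - b%:P) * ('X - c%:P) :> {poly int})
    (hp : prime p)
    (hpabc : ~ (p%:Z %| a * b * c)%Z) :
  (a = b -> b = c ->
     ((p%:Z %| x 0%N)%Z ->
      ~ (p%:Z %| 4 * a * x 1%N - x 2%N - 3 * a ^+ 2 * x 0%N)%Z ->
      dense (quotient_set (padic p) x)) /\
     (x 0%N = 0 ->
      (dense (quotient_set (padic p) x) <-> 4 * a * x 1%N <> x 2%N))) /\
  (a = c -> a <> b ->
     (p%:Z %| x 0%N)%Z ->
     ~ (p%:Z %| (a - b) * (x 2%N - x 1%N * (a + b) + x 0%N * a * b))%Z ->
     dense (quotient_set (padic p) x)).
Proof.
have [b1E b2E b3E] := cubic_vieta hchar.
have rec n : x n.+3 = b1 * x n.+2 + b2 * x n.+1 + b3 * x n.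
  by rewrite hrec // !subSS !subn0.
have hpa : ~ (p%:Z %| a)%Z by move=> h; apply: hpabc; rewrite -mulrA dvdz_mulr.
have hpb : ~ (p%:Z %| b)%Z by move=> h; apply: hpabc; rewrite mulrAC dvdz_mull.
have a0 : a != 0 by apply/eqP => a0; apply: hpa; rewrite a0 dvdz0.
split=> [ab bc|ac ab hx0 hQ].
  subst b c.
  have C0 : 2 * a ^+ 2 != 0 by rewrite mulf_neq0 // expf_neq0.
  have hx := triple_root_formula (x := x) (a := a).
  have {}hx := hx (fun n => ltac:(rewrite rec b1E b2E b3E; ring)).
  split=> [hx0 hD|x0].
    apply: (dense_of_quadratic_formula hp C0 hpa _ _ hx).
      by apply/eqP => D0; apply: hD; rewrite D0 dvdz0.
    (* The linear coefficient has valuation 0, so the constant term need only be divisible by [p],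
       as [x 0] is. *)
    rewrite logn_ndvdz //.
    by rewrite expn1 dvdz_mull.
  have DE : 4 * a * x 1%N - x 2%N - 3 * a ^+ 2 * x 0%N = 4 * a * x 1%N - x 2%N.
    by rewrite x0 mulr0 subr0.
  (* The constant term vanishes. If the linear one does too, a pure square remains; otherwise any
     valuation of it is allowed. *)
  split=> [dn eqD|/eqP neD].
    apply: (not_dense_of_square_formula hp C0 hpa _ dn) => n.
    by rewrite hx DE eqD subrr x0 mul0r mulr0 !add0r.
  apply: (dense_of_quadratic_formula hp C0 hpa _ _ hx).
    by rewrite DE subr_eq0.
  by rewrite x0 mulr0 dvdz0.
subst c.
have hx := double_root_formula (x := x) (a := a) (b := b).
have {}hx := hx (fun n => ltac:(rewrite rec b1E b2E b3E; ring)).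
apply: (dense_of_linear_formula hp _ hpa hpb hQ hx).
by rewrite mulf_neq0 // expf_neq0 // subr_eq0; apply/eqP.
Qed.
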